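(* Let $\beta_0,\beta_1\in(1/2,1)$ with $\beta_0\ge\beta_1$, let $I=[0,\beta_1/(1-\beta_1)]$, let $x\in I$, and let $s=(s_i)\in\{0,1\}^{\mathbb{N}}$ be a $(\beta_0,\beta_1)$-expansion of $x$. Then $s$ is the unique $(\beta_0,\beta_1)$-expansion of $x$ if and only if $$\pi_{\beta_0,\beta_1}(\sigma^k(s))\in[0,\beta_1)\cup\left(\frac{\beta_0\beta_1}{1-\beta_1},\frac{\beta_1}{1-\beta_1}\right]\quad\text{for all }k\ge0.$$
   Context: Let $\Sigma=\{0,1\}^{\mathbb{N}}$ be the set of sequences $s=(s_i)_{i\ge1}$ of zeros and ones. For $s\in\Sigma$ and $n\ge1$, let $0_n(s)$ be the number of zeros and $1_n(s)$ the number of ones among $s_1,\dots,s_n$. For $\beta_0,\beta_1\in(1/2,1)$ with $\beta_0\ge\beta_1$ and $I=[0,\beta_1/(1-\beta_1)]$, define $\pi_{\beta_0,\beta_1}:\Sigma\to I$ by $$\pi_{\beta_0,\beta_1}(s)=\sum_{i=1}^{\infty}s_i\,\beta_0^{0_i(s)}\beta_1^{1_i(s)}.$$ A sequence $s\in\Sigma$ with $\pi_{\beta_0,\beta_1}(s)=x$ is called a $(\beta_0,\beta_1)$-expansion of $x\in I$. The shift map $\sigma:\Sigma\to\Sigma$ is $\sigma((s_i)_{i\ge1})=(s_{i+1})_{i\ge1}$, and $\sigma^k$ is its $k$-th iterate ($\sigma^0$ is the identity). *)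

(* Defs.v *)
From Stdlib Require Import Reals List Lra Lia.
From Coquelicot Require Import Coquelicot.
Open Scope R_scope.

(** Binary digit sequences, indexed from 0: the n-th value of [s : Sigma] is the
    digit s_(n+1) of the sequence (s_i)_(i >= 1); [true] is 1 and [false] is 0. *)
Definition Sigma := nat -> bool.

Definition zeros (s : Sigma) (n : nat) : nat :=
  count_occ Bool.bool_dec (map s (seq 0 n)) false.

Definition ones (s : Sigma) (n : nat) : nat :=
  count_occ Bool.bool_dec (map s (seq 0 n)) true.

Definition digit (s : Sigma) (n : nat) : R := INR (Nat.b2n (s n)).

Definition pi_term (beta0 beta1 : R) (s : Sigma) (n : nat) : R :=
  digit s n * beta0 ^ zeros s (S n) * beta1 ^ ones s (S n).

Definition pi_beta (beta0 beta1 : R) (s : Sigma) : R :=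
  Series (pi_term beta0 beta1 s).

Definition is_expansion (beta0 beta1 x : R) (s : Sigma) : Prop :=
  pi_beta beta0 beta1 s = x.

Definition shift (s : Sigma) : Sigma := fun n => s (S n).

Lemma zeros_ones (s : Sigma) (n : nat) : (zeros s n + ones s n)%nat = n.
Proof.
unfold zeros, ones.
rewrite <- (length_seq n 0) at 3; rewrite <- (length_map s).
induction (map s (seq 0 n)) as [|[|] l IH]; simpl; lia.
Qed.

(** [Series] returns a junk value on divergent series; this rules it out. *)
Lemma ex_series_pi_term (beta0 beta1 : R) (s : Sigma) :
  0 < beta0 < 1 -> 0 < beta1 < 1 -> ex_series (pi_term beta0 beta1 s).
Proof.
intros H0 H1.
set (m := Rmax beta0 beta1).
assert (Hm : 0 < m < 1) by (unfold m, Rmax; destruct (Rle_dec beta0 beta1); lra).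
assert (L0 : beta0 <= m) by apply Rmax_l.
assert (L1 : beta1 <= m) by apply Rmax_r.
apply (ex_series_le (K := R_AbsRing) (V := R_CompleteNormedModule)
         (pi_term beta0 beta1 s) (fun n => m ^ n)).
- intros n; change (norm (pi_term beta0 beta1 s n))
    with (Rabs (pi_term beta0 beta1 s n)).
  assert (P0 := pow_le beta0 (zeros s (S n)) (Rlt_le _ _ (proj1 H0))).
  assert (P1 := pow_le beta1 (ones s (S n)) (Rlt_le _ _ (proj1 H1))).
  assert (Q0 : beta0 ^ zeros s (S n) <= m ^ zeros s (S n)) by (apply pow_incr; lra).
  assert (Q1 : beta1 ^ ones s (S n) <= m ^ ones s (S n)) by (apply pow_incr; lra).
  assert (D : 0 <= digit s n <= 1)
    by (unfold digit; destruct (s n); simpl; lra).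
  assert (E : m ^ zeros s (S n) * m ^ ones s (S n) = m * m ^ n)
    by (rewrite <- pow_add, zeros_ones; reflexivity).
  assert (Pm := pow_lt m n (proj1 Hm)).
  assert (B : 0 <= beta0 ^ zeros s (S n) * beta1 ^ ones s (S n) <= m * m ^ n)
    by (rewrite <- E; split;
        [apply Rmult_le_pos | apply Rmult_le_compat]; assumption).
  unfold pi_term; rewrite Rmult_assoc, Rabs_pos_eq; nra.
- apply ex_series_geom; rewrite Rabs_pos_eq; lra.
Qed.

(* Main.v *)
(** If [y] is the value of [s], then the tail of [s] has value [y / beta0] when [s]
    starts with 0 and [y / beta1 - 1] when it starts with 1; both tails have their
    value in [I]. So an expansion of [y] can start with 0 only if
    [y <= beta0 * beta1 / (1 - beta1)], and with 1 only if [beta1 <= y]. Outside the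
    switch region where both inequalities hold the digit is forced; inside it both
    digits occur, since every point of [I] has an expansion (the greedy one). *)
Require Import Defs.
From Stdlib Require Import Reals List Lra Lia FunctionalExtensionality.
From Coquelicot Require Import Coquelicot.
Open Scope R_scope.

(** * Branch maps and the range of values *)

(** The affine contraction by which prepending the digit [d] acts on values. *)
Definition branch (beta0 beta1 : R) (d : bool) (y : R) : R :=
  if d then beta1 * (1 + y) else beta0 * y.

Lemma map_seq_shift (s : Sigma) (n : nat) :
  map s (seq 0 (S n)) = s 0%nat :: map (shift s) (seq 0 n).
Proof.
simpl; rewrite <- seq_shift, map_map; reflexivity.
Qed.

Lemma pi_term_S (beta0 beta1 : R) (s : Sigma) (n : nat) :
  pi_term beta0 beta1 s (S n) =
  (if s 0%nat then beta1 else beta0) * pi_term beta0 beta1 (shift s) n.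
Proof.
unfold pi_term, zeros, ones.
rewrite (map_seq_shift s (S n)).
change (digit s (S n)) with (digit (shift s) n).
destruct (s 0%nat); simpl count_occ; rewrite <- tech_pow_Rmult; ring.
Qed.

Lemma pi_term_0 (beta0 beta1 : R) (s : Sigma) :
  pi_term beta0 beta1 s 0 = if s 0%nat then beta1 else 0.
Proof.
unfold pi_term, zeros, ones, digit; simpl.
destruct (s 0%nat); simpl; ring.
Qed.

Lemma pi_beta_branch (beta0 beta1 : R) (s : Sigma) :
  0 < beta0 < 1 -> 0 < beta1 < 1 ->
  pi_beta beta0 beta1 s =
  branch beta0 beta1 (s 0%nat) (pi_beta beta0 beta1 (shift s)).
Proof.
intros H0 H1; unfold pi_beta.
rewrite Series_incr_1 by (apply ex_series_pi_term; assumption).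
rewrite (Series_ext _ _ (pi_term_S beta0 beta1 s)), Series_scal_l, pi_term_0.
unfold branch; destruct (s 0%nat); ring.
Qed.

Lemma branch_range (beta0 beta1 : R) (d : bool) (y : R) :
  0 < beta0 < 1 -> 0 < beta1 < 1 ->
  0 <= y <= beta1 / (1 - beta1) ->
  0 <= branch beta0 beta1 d y <= beta1 / (1 - beta1).
Proof.
intros H0 H1 Hy.
(* The right endpoint of $I$ is the fixed point of the branch for digit 1, as 0 is for digit 0. *)
assert (E : beta1 * (1 + beta1 / (1 - beta1)) = beta1 / (1 - beta1))
  by (field; lra).
unfold branch; destruct d; nra.
Qed.

(** Partial sums obey the same recursion as values: a sum for [s] is the branch image of a shorter
    sum for [shift s]. Hence the induction is over all [s], and it peels off the first term. *)
Lemma sum_pi_term_range (beta0 beta1 : R) (s : Sigma) (n : nat) :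
  0 < beta0 < 1 -> 0 < beta1 < 1 ->
  0 <= sum_n (pi_term beta0 beta1 s) n <= beta1 / (1 - beta1).
Proof.
intros H0 H1; revert s; induction n as [|n IH]; intros s.
- assert (P : 0 <= beta1 / (1 - beta1)) by (apply Rdiv_le_0_compat; lra).
  assert (B := branch_range beta0 beta1 (s 0%nat) 0 H0 H1 (conj (Rle_refl 0) P)).
  rewrite sum_O, pi_term_0; unfold branch in B; destruct (s 0%nat); lra.
- assert (B := branch_range beta0 beta1 (s 0%nat) _ H0 H1 (IH (shift s))).
  enough (E : sum_n (pi_term beta0 beta1 s) (S n) =
    branch beta0 beta1 (s 0%nat) (sum_n (pi_term beta0 beta1 (shift s)) n) :> R)
    by (rewrite E; exact B).
  unfold sum_n at 1; rewrite sum_Sn_m by lia; rewrite <- sum_n_m_S.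
  change plus with Rplus.
  rewrite (sum_n_m_ext _ _ 0 n (pi_term_S beta0 beta1 s)).
  rewrite (sum_n_m_mult_l (K := R_Ring)), pi_term_0.
  change mult with Rmult; unfold branch, sum_n.
  destruct (s 0%nat); [|apply Rplus_0_l].
  rewrite Rmult_plus_distr_l, Rmult_1_r; reflexivity.
Qed.

Lemma pi_beta_range (beta0 beta1 : R) (s : Sigma) :
  0 < beta0 < 1 -> 0 < beta1 < 1 ->
  0 <= pi_beta beta0 beta1 s <= beta1 / (1 - beta1).
Proof.
intros H0 H1.
assert (L : is_lim_seq (sum_n (pi_term beta0 beta1 s)) (pi_beta beta0 beta1 s))
  by exact (Series_correct _ (ex_series_pi_term beta0 beta1 s H0 H1)).
split.
- apply (is_lim_seq_le (fun _ => 0) _ 0 (pi_beta beta0 beta1 s)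
           (fun n => proj1 (sum_pi_term_range beta0 beta1 s n H0 H1))
           (is_lim_seq_const 0) L).
- apply (is_lim_seq_le _ (fun _ => beta1 / (1 - beta1))
           (pi_beta beta0 beta1 s) (beta1 / (1 - beta1))
           (fun n => proj2 (sum_pi_term_range beta0 beta1 s n H0 H1))
           L (is_lim_seq_const _)).
Qed.

(** * Greedy expansions *)

Definition greedy_digit (beta1 y : R) : bool :=
  if Rle_dec beta1 y then true else false.

(** The value left for the tail once the greedy digit is chosen. *)
Definition greedy_map (beta0 beta1 y : R) : R :=
  if Rle_dec beta1 y then y / beta1 - 1 else y / beta0.

Fixpoint greedy (beta0 beta1 y : R) (n : nat) : bool :=
  match n with
  | O => greedy_digit beta1 y
  | S m => greedy beta0 beta1 (greedy_map beta0 beta1 y) m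
  end.

Lemma branch_greedy_map (beta0 beta1 y : R) :
  0 < beta0 -> 0 < beta1 ->
  branch beta0 beta1 (greedy_digit beta1 y) (greedy_map beta0 beta1 y) = y.
Proof.
intros H0 H1; unfold branch, greedy_digit, greedy_map.
destruct (Rle_dec beta1 y); field; lra.
Qed.

Lemma greedy_map_range (beta0 beta1 y : R) :
  0 < beta0 < 1 -> 0 < beta1 < 1 -> 1 <= beta0 + beta1 ->
  0 <= y <= beta1 / (1 - beta1) ->
  0 <= greedy_map beta0 beta1 y <= beta1 / (1 - beta1).
Proof.
intros H0 H1 Hsum Hy.
assert (E : beta1 / (1 - beta1) = beta1 * (1 + beta1 / (1 - beta1)))
  by (field; lra).
assert (B := branch_greedy_map beta0 beta1 y (proj1 H0) (proj1 H1)).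
unfold branch, greedy_digit in B; unfold greedy_map in *.
set (M := beta1 / (1 - beta1)) in *.
destruct (Rle_dec beta1 y) as [Hle|Hlt].
- split; apply (Rmult_le_reg_l beta1); lra.
- assert (HM : 0 <= M) by lra.
  (* By [E], [beta1 = (1 - beta1) * M], and [1 - beta1 <= beta0]: the images of the two branches
     leave no gap in $I$. *)
  assert (beta1 <= beta0 * M) by nra.
  split; apply (Rmult_le_reg_l beta0); lra.
Qed.

Lemma branch_dist (beta0 beta1 : R) (d : bool) (y z : R) :
  0 < beta0 -> 0 < beta1 ->
  Rabs (branch beta0 beta1 d y - branch beta0 beta1 d z) <=
  Rmax beta0 beta1 * Rabs (y - z).
Proof.
intros H0 H1.
assert (L0 := Rmax_l beta0 beta1); assert (L1 := Rmax_r beta0 beta1).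
assert (P := Rabs_pos (y - z)).
replace (branch beta0 beta1 d y - branch beta0 beta1 d z)
  with ((if d then beta1 else beta0) * (y - z))
  by (unfold branch; destruct d; ring).
rewrite Rabs_mult, (Rabs_pos_eq (if d then _ else _)) by (destruct d; lra).
apply Rmult_le_compat_r; destruct d; lra.
Qed.

(** Both [y] and the value of its greedy sequence are images under one common branch, so each step
    gains a factor [Rmax beta0 beta1]; at [n = 0] both points merely lie in $I$. *)
Lemma greedy_dist (beta0 beta1 : R) (n : nat) (y : R) :
  0 < beta0 < 1 -> 0 < beta1 < 1 -> 1 <= beta0 + beta1 ->
  0 <= y <= beta1 / (1 - beta1) ->
  Rabs (y - pi_beta beta0 beta1 (greedy beta0 beta1 y)) <=
  Rmax beta0 beta1 ^ n * (beta1 / (1 - beta1)).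
Proof.
intros H0 H1 Hsum; revert y; induction n as [|n IH]; intros y Hy.
- assert (R := pi_beta_range beta0 beta1 (greedy beta0 beta1 y) H0 H1).
  rewrite pow_O; apply Rabs_le; lra.
- assert (IHn := IH _ (greedy_map_range beta0 beta1 y H0 H1 Hsum Hy)).
  rewrite pi_beta_branch by assumption.
  rewrite <- (branch_greedy_map beta0 beta1 y) at 1 by lra.
  eapply Rle_trans; [apply branch_dist; lra|].
  rewrite <- tech_pow_Rmult, Rmult_assoc.
  apply Rmult_le_compat_l; [|exact IHn].
  assert (L0 := Rmax_l beta0 beta1); lra.
Qed.

Lemma greedy_expansion (beta0 beta1 y : R) :
  0 < beta0 < 1 -> 0 < beta1 < 1 -> 1 <= beta0 + beta1 ->
  0 <= y <= beta1 / (1 - beta1) ->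
  is_expansion beta0 beta1 y (greedy beta0 beta1 y).
Proof.
intros H0 H1 Hsum Hy; unfold is_expansion.
set (m := Rmax beta0 beta1).
assert (Hm : Rabs m < 1).
{ assert (L0 := Rmax_l beta0 beta1).
  rewrite Rabs_pos_eq by (unfold m; lra); apply Rmax_lub_lt; lra. }
assert (L := is_lim_seq_scal_r _ (beta1 / (1 - beta1)) _ (is_lim_seq_geom m Hm)).
simpl in L; rewrite Rmult_0_l in L.
assert (D : Rabs (y - pi_beta beta0 beta1 (greedy beta0 beta1 y)) <= 0)
  by exact (is_lim_seq_le (fun _ => _) _ (Finite _) 0
              (fun n => greedy_dist beta0 beta1 n y H0 H1 Hsum Hy)
              (is_lim_seq_const _) L).
apply Rabs_le_between in D; lra.
Qed.

(** * Changing a sequence from a given position on *)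

Definition scons (d : bool) (t : Sigma) : Sigma :=
  fun n => match n with O => d | S m => t m end.

(** By eta, [shift (scons d t)] is convertible to [t]. *)
Lemma pi_beta_scons (beta0 beta1 : R) (d : bool) (t : Sigma) :
  0 < beta0 < 1 -> 0 < beta1 < 1 ->
  pi_beta beta0 beta1 (scons d t) =
  branch beta0 beta1 d (pi_beta beta0 beta1 t).
Proof.
exact (pi_beta_branch beta0 beta1 (scons d t)).
Qed.

Lemma iter_shift (s : Sigma) (k n : nat) :
  Nat.iter k shift s n = s (k + n)%nat.
Proof.
revert n; induction k as [|k IH]; intros n; [reflexivity|].
simpl; unfold shift at 1; rewrite IH; f_equal; lia.
Qed.

(** A tail enters the value of the whole sequence only through its own value, so the first [k]
    digits of [s] can be put in front of [u]. *)
Lemma replace_tail (beta0 beta1 : R) (k : nat) (s u : Sigma) :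
  0 < beta0 < 1 -> 0 < beta1 < 1 ->
  pi_beta beta0 beta1 u = pi_beta beta0 beta1 (Nat.iter k shift s) ->
  exists t : Sigma, pi_beta beta0 beta1 t = pi_beta beta0 beta1 s /\
    Nat.iter k shift t = u.
Proof.
intros H0 H1; revert s; induction k as [|k IH]; intros s Hu.
- exists u; split; [exact Hu | reflexivity].
- rewrite Nat.iter_succ_r in Hu.
  destruct (IH (shift s) Hu) as [t [Ht Htu]].
  exists (scons (s 0%nat) t); split.
  + rewrite pi_beta_scons, Ht, <- pi_beta_branch by assumption; reflexivity.
  + rewrite Nat.iter_succ_r; exact Htu.
Qed.

Lemma switch_expansion (beta0 beta1 y : R) (d : bool) :
  0 < beta0 < 1 -> 0 < beta1 < 1 -> 1 <= beta0 + beta1 ->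
  beta1 <= y <= beta0 * beta1 / (1 - beta1) ->
  exists u : Sigma, is_expansion beta0 beta1 y u /\ u 0%nat = d.
Proof.
intros H0 H1 Hsum Hy.
assert (E1 : beta1 / (1 - beta1) = beta1 * (1 + beta1 / (1 - beta1)))
  by (field; lra).
assert (E0 : beta0 * beta1 / (1 - beta1) = beta0 * (beta1 / (1 - beta1)))
  by (field; lra).
(* The preimage of [y] under the branch of [d]; it stays in $I$ for either digit because [y] is in
   the switch region. *)
set (z := if d then y / beta1 - 1 else y / beta0).
assert (B : branch beta0 beta1 d z = y)
  by (unfold branch, z; destruct d; field; lra).
assert (Hz : 0 <= z <= beta1 / (1 - beta1)).
{ unfold branch in B; destruct d; split.
  - apply (Rmult_le_reg_l beta1); lra.
  - assert (beta0 * (beta1 / (1 - beta1)) <= beta1 / (1 - beta1)) by nra.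
    apply (Rmult_le_reg_l beta1); lra.
  - apply (Rmult_le_reg_l beta0); lra.
  - apply (Rmult_le_reg_l beta0); lra. }
exists (scons d (greedy beta0 beta1 z)); split; [|reflexivity].
unfold is_expansion; rewrite pi_beta_scons by assumption.
rewrite (greedy_expansion beta0 beta1 z H0 H1 Hsum Hz); exact B.
Qed.

(** The branches map $I$ onto [[0, beta0 * beta1 / (1 - beta1)]] and [[beta1, beta1 / (1 - beta1)]].
    Different first digits would put the common value in both; with equal digits, injectivity of the
    branch gives equal tail values. *)
Lemma forced_digit (beta0 beta1 : R) (s t : Sigma) :
  0 < beta0 < 1 -> 0 < beta1 < 1 ->
  pi_beta beta0 beta1 t = pi_beta beta0 beta1 s ->
  pi_beta beta0 beta1 s < beta1 \/
  beta0 * beta1 / (1 - beta1) < pi_beta beta0 beta1 s ->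
  t 0%nat = s 0%nat /\
  pi_beta beta0 beta1 (shift t) = pi_beta beta0 beta1 (shift s).
Proof.
intros H0 H1 Heq Hout.
assert (Rs := pi_beta_range beta0 beta1 (shift s) H0 H1).
assert (Rt := pi_beta_range beta0 beta1 (shift t) H0 H1).
assert (E0 : beta0 * beta1 / (1 - beta1) = beta0 * (beta1 / (1 - beta1)))
  by (field; lra).
rewrite (pi_beta_branch beta0 beta1 t), (pi_beta_branch beta0 beta1 s) in Heq
  by assumption.
rewrite (pi_beta_branch beta0 beta1 s) in Hout by assumption.
unfold branch in Heq, Hout.
destruct (s 0%nat), (t 0%nat).
- split; [reflexivity|]; apply (Rmult_eq_reg_l beta1); lra.
- exfalso; destruct Hout; nra.
- exfalso; destruct Hout; nra.
- split; [reflexivity|]; apply (Rmult_eq_reg_l beta0); lra.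
Qed.

Theorem proposition5p1 (beta0 beta1 : R)
  (Hbeta0 : 1 / 2 < beta0 < 1) (Hbeta1 : 1 / 2 < beta1 < 1)
  (Hbeta : beta0 >= beta1)
  (x : R) (Hx : 0 <= x <= beta1 / (1 - beta1))
  (s : Sigma) (Hs : is_expansion beta0 beta1 x s) :
  (forall t : Sigma, is_expansion beta0 beta1 x t -> t = s)
  <->
  (forall k : nat,
     let y := pi_beta beta0 beta1 (Nat.iter k shift s) in
     0 <= y < beta1 \/
     beta0 * beta1 / (1 - beta1) < y <= beta1 / (1 - beta1)).
Proof.
assert (H0 : 0 < beta0 < 1) by lra.
assert (H1 : 0 < beta1 < 1) by lra.
assert (Hsum : 1 <= beta0 + beta1) by lra.
split.
- intros Huniq k y.
  assert (Ry : 0 <= y <= beta1 / (1 - beta1))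
    by (apply pi_beta_range; assumption).
  destruct (Rlt_le_dec y beta1) as [?|Hlo]; [left; lra|].
  destruct (Rlt_le_dec (beta0 * beta1 / (1 - beta1)) y) as [?|Hhi];
    [right; lra|].
  exfalso.
  (* Choosing the digit opposite to that of [s] at position [k] makes the new expansion differ from
     [s]. *)
  destruct (switch_expansion beta0 beta1 y (negb (Nat.iter k shift s 0%nat))
              H0 H1 Hsum (conj Hlo Hhi)) as [u [Hu Hd]].
  destruct (replace_tail beta0 beta1 k s u H0 H1 Hu) as [t [Ht Htu]].
  rewrite (Huniq t (eq_trans Ht Hs)) in Htu; rewrite Htu in Hd.
  destruct (u 0%nat); discriminate.
- intros Hout t Ht.
  (* Equality of tail values propagates by induction; the digits are then compared one position at a
     time. *)
  assert (V : forall k, pi_beta beta0 beta1 (Nat.iter k shift t) =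
                        pi_beta beta0 beta1 (Nat.iter k shift s)).
  { induction k as [|k IH]; [exact (eq_trans Ht (eq_sym Hs))|].
    apply (forced_digit beta0 beta1 _ _ H0 H1 IH).
    specialize (Hout k); simpl in Hout; tauto. }
  apply functional_extensionality; intros k.
  assert (D : Nat.iter k shift t 0%nat = Nat.iter k shift s 0%nat).
  { apply (forced_digit beta0 beta1 _ _ H0 H1 (V k)).
    specialize (Hout k); simpl in Hout; tauto. }
  rewrite !iter_shift, Nat.add_0_r in D; exact D.
Qed.
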